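(* Consider the problem $$\partial_t f-\partial_x^2 f=0$$ on $\mathbb{R}$ for an initial data $f_0\in C^j(\mathbb{R},\mathbb{R})$, $j\geqslant 1$, and suppose that there exist $\kappa_1,\kappa_2>0$ and $\alpha\in(0,1)$ such that, for all $y\in\mathbb{R}$, $$\frac{\kappa_2}{(1+|y|)^{\alpha}}\geqslant f_0(y)\geqslant\frac{\kappa_1}{(1+|y|)^{\alpha}},$$ and that for any $i\in\mathbb{N}$ with $i\leqslant j$ there exists $\lambda_i>0$ such that, for all $y\in\mathbb{R}$, $$|f_0^{(i)}(y)|\leqslant\frac{\lambda_i}{(1+|y|)^{\alpha+i}}.$$ Then for any $n,k\in\mathbb{N}$, there exists $K_{n,k}>0$ depending on $\kappa_1,\kappa_2,\alpha,n,k$ such that, for $t\geqslant 0$ and $n+k\leqslant j$, $$\|\partial_t^n\partial_x^k f(\cdot,t)\|_{L^\infty(\mathbb{R})}\leqslant\frac{K_{n,k}}{(1+t)^{\frac{\alpha}{2}+n+\frac{k}{2}}}.$$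
   Context: Here $f$ is the solution of the heat equation with initial data $f(\cdot,0)=f_0$, given for $t>0$ by $f(x,t)=\frac{1}{\sqrt{4\pi t}}\int_{\mathbb{R}}f_0(y)e^{-\frac{(x-y)^2}{4t}}\,dy$, and $f_0^{(i)}$ denotes the $i$-th derivative of $f_0$.
   Formalization: The printed claim fails near t=0; proved instead: for 2n+k≤j the bound holds for all t≥0 with K depending also on the λ_i; for n+k≤j it holds for t≥τ, any τ>0, with K depending on κ1, κ2, α, n, k and τ. *)

(* Defs.v *)
From HB Require Import structures.
From mathcomp Require Import all_boot all_order all_algebra.
From mathcomp Require Import all_classical all_reals all_analysis.
Set Implicit Arguments.
Unset Strict Implicit.
Unset Printing Implicit Defensive.
Import Order.TTheory GRing.Theory Num.Theory.
Import numFieldNormedType.Exports.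
Local Open Scope classical_set_scope.
Local Open Scope ring_scope.

(* C^j(R, R); continuity of the derivatives of order < j is implied. *)
Definition Cj (R : realType) (j : nat) (g : R -> R) : Prop :=
  (forall (i : nat) (x : R), (i < j)%N -> derivable (derive1n i g) x 1) /\
  continuous (derive1n j g).

Definition initial_data (R : realType) (kappa1 kappa2 alpha : R)
    (lambda : nat -> R) (j : nat) (f0 : R -> R) : Prop :=
  [/\ (1 <= j)%N,
      Cj j f0,
      (forall y : R, kappa1 / (1 + `|y|) `^ alpha <= f0 y
                     /\ f0 y <= kappa2 / (1 + `|y|) `^ alpha) &
      (forall i : nat, (i <= j)%N ->
         0 < lambda i /\
         forall y : R, `|derive1n i f0 y| <= lambda i / (1 + `|y|) `^ (alpha + i%:R))].

(* Only the values at t >= 0 are meaningful. *)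
Definition heat (R : realType) (f0 : R -> R) (x t : R) : R :=
  if 0 < t then
    (Num.sqrt (4 * pi * t))^-1 *
    \int[lebesgue_measure]_y (f0 y * expR (- ((x - y) ^+ 2 / (4 * t))))
  else f0 x.

(* Time differentiation on [0, +oo[: the increments h are restricted to
   t + h >= 0, hence the derivative at t = 0 is the right derivative, and the
   derivative at t > 0 is the usual one. *)
Definition time_quotient (R : realType) (g : R -> R) (t h : R) : R :=
  h^-1 * (g (t + h) - g t).

Definition time_derivable (R : realType) (g : R -> R) (t : R) : Prop :=
  cvg (time_quotient g t @ within [set h | 0 <= t + h] (0:R)^').

Definition time_derive (R : realType) (g : R -> R) (t : R) : R :=
  lim (time_quotient g t @ within [set h | 0 <= t + h] (0:R)^').

Definition dtdx (R : realType) (n k : nat) (f : R -> R -> R) (x t : R) : R :=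
  iter n (@time_derive R) (fun s : R => derive1n k (f ^~ s) x) t.

(* Derivatives are total functions here; this says that all those involved in
   dtdx n k f are genuine limits at the times of I. *)
Definition has_dtdx (R : realType) (n k : nat) (f : R -> R -> R) (I : set R) :
    Prop :=
  (forall (i : nat) (x s : R), (i < k)%N -> I s ->
     derivable (derive1n i (f ^~ s)) x 1) /\
  (forall (i : nat) (x s : R), (i < n)%N -> I s ->
     time_derivable (dtdx i k f x) s).

(* Main.v *)
Require Import Defs.
From HB Require Import structures.
From mathcomp Require Import all_boot all_order all_algebra.
From mathcomp Require Import all_classical all_reals all_analysis.
From mathcomp Require Import measurable_realfun ess_sup_inf ring lra.
Import Order.TTheory GRing.Theory Num.Theory.
Import numFieldNormedType.Exports.
Local Open Scope classical_set_scope.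
Local Open Scope ring_scope.

(** Let G_t be the heat kernel, so that for t > 0 the solution is the
    convolution of G_t with f_0, and let p = 2n + k.  Since G solves the heat
    equation, a time derivative of the kernel is two space derivatives, and for
    t > 0 the function d_t^n d_x^k f is the convolution of f_0 with the p-th
    space derivative of G_t ([dkernel p t]); this only requires f_0 to be
    bounded and continuous, and follows by differentiating under the integral
    sign ([is_derive_dheat_space], [is_derive_dheat_time]).

    Decay.  Up to a constant, the p-th derivative of G_t is at most
    t^(-p/2) G_(2t) ([dkernel_gauss_bound]), because a polynomial times a
    Gaussian is bounded by a wider Gaussian.  It remains to bound the convolution
    of G_t with the weight (1 + |y|)^(-alpha) by t^(-alpha/2).  Where
    |y| > sqrt t the weight is at most t^(-alpha/2) and G_t has mass 1; where
    |y| <= sqrt t one has G_t <= t^(-1/2), and the weight has integral of order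
    t^((1 - alpha)/2) on this interval because alpha < 1
    ([weighted_kernel_bound]).  Hence the derivative is O(t^(-(alpha + p)/2)),
    which on [tau, +oo[ is the required power of 1 + t.  The constant only
    involves the upper bound on f_0.

    Small times.  When f_0 has p bounded derivatives, they can be moved from the
    kernel to the data by an integration by parts ([dheat1_derive]), so that
    d_t^n d_x^k f is the heat flow of f_0^(p), and is bounded by the supremum of
    |f_0^(p)| because G_t is a probability density ([heat_bound]).  The formula
    persists at t = 0: the heat flow of bounded continuous data tends to the data
    as t -> 0+ ([heat_cvg_initial]), so by the mean value theorem the right
    derivative at 0 of the flow of g is the limit g'' of the derivatives at
    positive times ([is_time_derive_heat]).  The first part of the theorem uses
    this bound on [0, 1] and the decay estimate on [1, +oo[. *)

Set Implicit Arguments.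
Unset Strict Implicit.
Unset Printing Implicit Defensive.

(** * Derivatives of the heat kernel *)

Definition heat_kernel {R : realType} (t z : R) : R :=
  (Num.sqrt (4 * pi * t))^-1 * expR (- (z ^+ 2 / (4 * t))).

(** The p-th space derivative of the heat kernel G.  The recursion is Leibniz' rule
    applied p times to d_z G = - z / (2 t) G; up to scaling it is the three-term
    recursion of the Hermite polynomials, and it makes both the derivatives and
    the bounds accessible by induction. *)
Fixpoint dkernel {R : realType} (p : nat) (t z : R) : R :=
  match p with
  | 0 => heat_kernel t z
  | q.+1 => - (2 * t)^-1 *
      (z * dkernel q t z +
       match q with 0 => 0 | r.+1 => q%:R * dkernel r t z end)
  end.

Lemma dkernelS {R : realType} p (t z : R) :
  dkernel p.+1 t z =
  - (2 * t)^-1 * (z * dkernel p t z + p%:R * dkernel p.-1 t z).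
Proof. by case: p => [|p] //=; rewrite mul0r. Qed.

Lemma is_derive_heat_kernel_space {R : realType} (t z : R) : 0 < t ->
  is_derive z 1 (heat_kernel t) (dkernel 1 t z).
Proof.
move=> t0.
have H1 : is_derive z (1 : R) (fun z : R => - (z ^+ 2 / (4 * t))) (- (z / (2 * t))).
  have Hq : is_derive z (1 : R) (fun z : R => (- (4 * t)^-1) * z ^+ 2)
                (- (4 * t)^-1 * (2 * z)).
    have H := is_deriveZ (- (4 * t)^-1) (is_deriveX 2 (is_derive_id z (1 : R))).
    apply: (is_derive_eq H).
    by rewrite /= expr1 /GRing.scale /= mulr1.
  rewrite (_ : (fun _ => _) = (fun z : R => (- (4 * t)^-1) * z ^+ 2)); last first.
    by apply/funext => y /=; rewrite mulrC mulNr.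
  apply: (is_derive_eq Hq); field; lra.
have H2 := is_derive1_comp (is_derive_expR _) H1.
have H := is_deriveZ (Num.sqrt (4 * pi * t))^-1 H2.
apply: (is_derive_eq H); rewrite /GRing.scale /= /heat_kernel; field.
by rewrite !lt0r_neq0 // sqrtr_gt0 !mulr_gt0 // pi_gt0.
Qed.

Lemma is_derive_heat_kernel_time {R : realType} (t z : R) : 0 < t ->
  is_derive t 1 (heat_kernel ^~ z) (dkernel 2 t z).
Proof.
move=> t0; have pi0 := pi_gt0 R.
have pt0 : 0 < 4 * pi * t by nra.
have Hs : is_derive t (1 : R) (fun s : R => (Num.sqrt (4 * pi * s))^-1)
    (- (2 * t)^-1 * (Num.sqrt (4 * pi * t))^-1).
  have s0 : 0 < Num.sqrt (4 * pi * t) by rewrite sqrtr_gt0.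
  have Hl : is_derive t (1 : R) (fun s : R => 4 * pi * s) (4 * pi).
    have H := is_deriveZ (4 * pi) (is_derive_id t (1 : R)).
    by apply: (is_derive_eq H); rewrite /GRing.scale /= mulr1.
  have Hc := is_derive1_comp (is_derive1_sqrt pt0) Hl.
  have Hv := @is_deriveV _ _ t _ 1 (lt0r_neq0 s0) Hc.
  apply: (is_derive_eq Hv); rewrite /GRing.scale /=.
  have e : Num.sqrt (4 * pi * t) ^+ 2 = 4 * pi * t by rewrite sqr_sqrtr // ltW.
  set s := Num.sqrt _ in s0 e *.
  have -> : t = s ^+ 2 / (4 * pi)
    by rewrite e; move: (pi : R) pi0 => q q0; field; lra.
  move: (pi : R) pi0 => q q0.
  by field; lra.
have He : is_derive t (1 : R) (fun s : R => - (z ^+ 2 / (4 * s)))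
    (z ^+ 2 / (4 * t ^+ 2)).
  have Hl : is_derive t (1 : R) (fun s : R => 4 * s) 4.
    have H := is_deriveZ (4 : R) (is_derive_id t (1 : R)).
    by apply: (is_derive_eq H); rewrite /GRing.scale /= mulr1.
  have t4 : 4 * t != 0 by lra.
  have Hv := @is_deriveV _ _ t _ 1 t4 Hl.
  have H := is_deriveZ (- z ^+ 2) Hv.
  rewrite (_ : (fun _ => _) = (fun s : R => - z ^+ 2 * (4 * s)^-1)); last first.
    by apply/funext => y /=; rewrite mulNr.
  by apply: (is_derive_eq H); rewrite /GRing.scale /=; field; lra.
have He2 := is_derive1_comp (is_derive_expR _) He.
have H := is_deriveM Hs He2.
apply: (is_derive_eq H); rewrite /GRing.scale /= /heat_kernel; field.
by rewrite !lt0r_neq0 // sqrtr_gt0.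
Qed.

Lemma is_derive_dkernel_space {R : realType} p (t z : R) : 0 < t ->
  is_derive z 1 (dkernel p t) (dkernel p.+1 t z).
Proof.
move=> t0.
(* the recursion has depth two, hence the strengthening to p and p + 1 *)
suff : is_derive z 1 (dkernel p t) (dkernel p.+1 t z) /\
       is_derive z 1 (dkernel p.+1 t) (dkernel p.+2 t z) by case.
elim: p => [|p [IH0 IH1]].
  split; first exact: is_derive_heat_kernel_space.
  have H := is_deriveZ (- (2 * t)^-1)
    (is_deriveM (is_derive_id z (1 : R)) (is_derive_heat_kernel_space z t0)).
  rewrite (_ : dkernel 1 t = fun y => - (2 * t)^-1 * (y * heat_kernel t y));
    last by apply/funext => y /=; rewrite addr0.
  by apply: (is_derive_eq H); rewrite /GRing.scale /=; field; lra.
split=> //.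
have H := is_deriveZ (- (2 * t)^-1) (is_deriveD
    (is_deriveM (is_derive_id z (1 : R)) IH1) (is_deriveZ (p.+1%:R : R) IH0)).
apply: (is_derive_eq H); rewrite [in RHS]dkernelS /GRing.scale /=.
by rewrite -[p.+2%:R]natr1; ring.
Qed.

(** The heat equation for the derivatives of the kernel: one derivative in time
    raises the order in space by two. *)
Lemma is_derive_dkernel_time {R : realType} p (t z : R) : 0 < t ->
  is_derive t 1 (fun s => dkernel p s z) (dkernel p.+2 t z).
Proof.
move=> t0.
have Hi : is_derive t (1 : R) (fun s : R => - (2 * s)^-1) ((2 * t ^+ 2)^-1).
  have Hl : is_derive t (1 : R) (fun s : R => 2 * s) 2.
    have H := is_deriveZ (2 : R) (is_derive_id t (1 : R)).
    by apply: (is_derive_eq H); rewrite /GRing.scale /= mulr1.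
  have t2 : 2 * t != 0 by lra.
  have H := is_deriveN (@is_deriveV _ _ t _ 1 t2 Hl).
  by apply: (is_derive_eq H); rewrite /GRing.scale /=; field; lra.
suff : is_derive t 1 (fun s => dkernel p s z) (dkernel p.+2 t z) /\
       is_derive t 1 (fun s => dkernel p.+1 s z) (dkernel p.+3 t z) by case.
elim: p => [|p [IH0 IH1]].
  split; first exact: is_derive_heat_kernel_time.
  have H := is_deriveM Hi (is_deriveZ z (is_derive_heat_kernel_time z t0)).
  rewrite (_ : (fun s => _) = fun s => - (2 * s)^-1 * (z * heat_kernel s z));
    last by apply/funext => y /=; rewrite addr0.
  by apply: (is_derive_eq H); rewrite /GRing.scale /= /GRing.scale /=; field; lra.
split=> //.
have H := is_deriveM Hi (is_deriveD
    (is_deriveZ z IH1) (is_deriveZ (p.+1%:R : R) IH0)).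
apply: (is_derive_eq H).
transitivity (- (2 * t)^-1 * (z * dkernel p.+3 t z + p.+1%:R * dkernel p.+2 t z)
  + (z * dkernel p.+1 t z + p.+1%:R * dkernel p t z) * (2 * t ^+ 2)^-1).
  by [].
have eS q : dkernel q.+2 t z =
    - (2 * t)^-1 * (z * dkernel q.+1 t z + q.+1%:R * dkernel q t z).
  exact: dkernelS.
rewrite (eS p.+2) (eS p) -[p.+3%:R]natr1 -[p.+2%:R]natr1.
move: (dkernel p.+3 t z) (dkernel p.+1 t z) (dkernel p t z) => a3 a1 a0.
by field; lra.
Qed.

(** * Gaussian bounds *)

Lemma heat_kernel_ge0 {R : realType} (t z : R) : 0 <= heat_kernel t z.
Proof. by rewrite mulr_ge0 ?expR_ge0 // invr_ge0 sqrtr_ge0. Qed.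

Lemma heat_kernel_normal_pdf {R : realType} (t x y : R) : 0 < t ->
  normal_pdf x (Num.sqrt (2 * t)) y = heat_kernel t (x - y).
Proof.
move=> t0; have t2 : 0 <= 2 * t by lra.
rewrite normal_pdfE; last by rewrite gt_eqF // sqrtr_gt0; lra.
rewrite /normal_peak /normal_fun /heat_kernel sqr_sqrtr //.
congr (_^-1 * expR _); first by congr Num.sqrt; ring.
by field; lra.
Qed.

Lemma integrable_heat_kernel {R : realType} (t x : R) : 0 < t ->
  (@lebesgue_measure R).-integrable setT (EFin \o (fun y => heat_kernel t (x - y))).
Proof.
move=> t0; apply: eq_integrable (integrable_normal_pdf x (Num.sqrt (2 * t))) => //.
by move=> y _ /=; rewrite heat_kernel_normal_pdf.
Qed.

Lemma Rintegral_heat_kernel {R : realType} (t x : R) : 0 < t ->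
  \int[@lebesgue_measure R]_y heat_kernel t (x - y) = 1.
Proof.
move=> t0; under eq_Rintegral do rewrite -heat_kernel_normal_pdf //.
by rewrite /Rintegral integral_normal_pdf.
Qed.

(** In the self-similar variable v = |z| / sqrt t the p-th derivative is
    t^(-p/2) G_t times a polynomial of degree p in v. *)
Lemma dkernel_poly_bound {R : realType} (p : nat) :
  exists2 A : R, 0 <= A & forall t z : R, 0 < t ->
  `|dkernel p t z| <= A * (Num.sqrt t)^-1 ^+ p *
                      (1 + `|z| / Num.sqrt t) ^+ p * heat_kernel t z.
Proof.
pose P q (A : R) := 0 <= A /\ forall t z : R, 0 < t ->
  `|dkernel q t z| <= A * (Num.sqrt t)^-1 ^+ q *
                      (1 + `|z| / Num.sqrt t) ^+ q * heat_kernel t z.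
suff [[A [A0 HA]] _] : (exists A, P p A) /\ (exists A, P p.+1 A) by exists A.
have tE t : 0 < t -> (2 * t)^-1 = (Num.sqrt t)^-1 ^+ 2 / 2 :> R.
  by move=> t0; rewrite exprVn sqr_sqrtr ?ltW //; field; lra.
elim: p => [|p [[A0 [A00 H0]] [A1 [A10 H1]]]].
  split.
    exists 1; split => // t z t0; rewrite !expr0 !mul1r.
    by rewrite ger0_norm // heat_kernel_ge0.
  exists 1; split => // t z t0; rewrite !expr1 mul1r dkernelS /= mul0r addr0.
  rewrite normrM [`|z * _|]normrM normrN (ger0_norm (heat_kernel_ge0 _ _)) normfV.
  rewrite (@ger0_norm _ (2 * t)); last lra.
  rewrite tE // mulrA ler_wpM2r ?heat_kernel_ge0 //.
  have i0 : 0 < (Num.sqrt t)^-1 by rewrite invr_gt0 sqrtr_gt0.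
  have := normr_ge0 z; move: (Num.sqrt t)^-1 `|z| i0 => i v i0 v0.
  nra.
split; first by exists A1.
exists (A1 + p.+1%:R * A0); split => [|t z t0]; first by rewrite addr_ge0 // mulr_ge0.
have i0 : 0 < (Num.sqrt t)^-1 by rewrite invr_gt0 sqrtr_gt0.
rewrite dkernelS normrM normrN normfV (@ger0_norm _ (2 * t)); last lra.
rewrite tE //.
have := H1 t z t0; have := H0 t z t0.
have := heat_kernel_ge0 t z; have := normr_ge0 z.
rewrite (_ : p.+1.-1 = p) //.
move: (Num.sqrt t)^-1 i0 (heat_kernel t z) => i i0 K v0 K0 B0 B1.
have := ler_normD (z * dkernel p.+1 t z) (p.+1%:R * dkernel p t z).
rewrite [`|z * _|]normrM [`|p.+1%:R * _|]normrM (@ger0_norm _ p.+1%:R) // => B2.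
set v := `|z| in v0 B0 B1 B2 *; set n := p.+1%:R in B2 *.
have n0 : 0 <= n by rewrite /n ler0n.
set q := 1 + v * i in B0 B1 *.
have vi0 : 0 <= v * i by rewrite mulr_ge0 // ltW.
have q1 : 1 <= q by rewrite /q lerDl.
have {}B2 : `|z * dkernel p.+1 t z + n * dkernel p t z| <=
    v * (A1 * i ^+ p.+1 * q ^+ p.+1 * K) + n * (A0 * i ^+ p * q ^+ p * K).
  by apply: (le_trans B2); apply: lerD; rewrite ler_wpM2l.
apply: (@le_trans _ _ (i ^+ 2 / 2 *
   (v * (A1 * i ^+ p.+1 * q ^+ p.+1 * K) + n * (A0 * i ^+ p * q ^+ p * K)))).
  by rewrite ler_wpM2l // divr_ge0 // sqr_ge0.
set I := i ^+ p * q ^+ p * K * i ^+ 2.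
have I0 : 0 <= I.
  by do !apply: mulr_ge0; rewrite ?exprn_ge0 //; lra.
rewrite [leLHS](_ : _ = I * ((A1 * (v * i) * q + n * A0) / 2)); last first.
  by rewrite /I !exprS expr0; field.
rewrite [leRHS](_ : _ = I * ((A1 + n * A0) * q ^+ 2)); last first.
  by rewrite /I !exprS expr0; field.
rewrite ler_wpM2l //.
have nA0 : 0 <= n * A0 by rewrite mulr_ge0.
have h1 : A1 * (v * i) * q <= A1 * q ^+ 2.
  rewrite expr2 [leRHS]mulrA; apply: ler_wpM2r; first lra.
  by apply: ler_wpM2l => //; rewrite /q; lra.
have h2 : n * A0 <= n * A0 * q ^+ 2 by rewrite ler_peMr // exprn_ege1.
have h3 : 0 <= A1 * q ^+ 2 by rewrite mulr_ge0 // sqr_ge0.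
by rewrite mulrDl; lra.
Qed.

(** Absorbs a polynomial into half of the Gaussian exponent. *)
Lemma poly_gauss_bound {R : realType} (p : nat) (v : R) : 0 <= v ->
  (1 + v) ^+ p * expR (- (v ^+ 2 / 4)) <=
  p`!%:R * expR 3 * expR (- (v ^+ 2 / 8)).
Proof.
move=> v0.
have h1 : (1 + v) ^+ p <= p`!%:R * expR (1 + v).
  case: p => [|p].
    by rewrite expr0 fact0 mul1r -[leLHS]expR0 ler_expR; lra.
  have f0 : 0 < (p.+1)`!%:R :> R by rewrite ltr0n fact_gt0.
  have := @expR_ge1Dxn R (1 + v) p ltac:(lra).
  rewrite -ler_pdivrMl // mulrC; lra.
apply: (@le_trans _ _ (p`!%:R * expR (1 + v) * expR (- (v ^+ 2 / 4)))).
  by rewrite ler_wpM2r // expR_ge0.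
(* 1 + v - v ^ 2 / 8 is maximal at v = 4, with value 3 *)
rewrite -!mulrA -!expRD ler_wpM2l // ler_expR.
have := sqr_ge0 (v - 4); rewrite !expr2; lra.
Qed.

Lemma heat_factor_double {R : realType} (t : R) : 0 < t ->
  (Num.sqrt (4 * pi * t))^-1 <= 2 * (Num.sqrt (4 * pi * (2 * t)))^-1.
Proof.
move=> t0; have pt0 : 0 < 4 * pi * t by rewrite !mulr_gt0 // pi_gt0.
rewrite -[leRHS]invrK invfM invrK lef_pV2 ?posrE ?mulr_gt0 ?sqrtr_gt0 //; last first.
  by rewrite mulrCA; lra.
have -> : 4 * pi * (2 * t) = 2 * (4 * pi * t) by ring.
rewrite sqrtrM // mulrA ger_pMl ?sqrtr_gt0 //.
have : Num.sqrt 2 <= Num.sqrt (2 ^+ 2) :> R by rewrite ler_sqrt //; lra.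
rewrite sqrtr_sqr ger0_norm //; lra.
Qed.

Lemma dkernel_gauss_bound {R : realType} (p : nat) :
  exists2 C : R, 0 <= C & forall t z : R, 0 < t ->
  `|dkernel p t z| <= C * (Num.sqrt t)^-1 ^+ p * heat_kernel (2 * t) z.
Proof.
have [A A0 HA] := @dkernel_poly_bound R p.
exists (A * (p`!%:R * expR 3) * 2); first by rewrite !mulr_ge0 // expR_ge0.
move=> t z t0; apply: (le_trans (HA t z t0)).
have s0 : 0 < Num.sqrt t by rewrite sqrtr_gt0.
have st : Num.sqrt t ^+ 2 = t by rewrite sqr_sqrtr // ltW.
have v0 : 0 <= `|z| / Num.sqrt t by rewrite divr_ge0 // ltW.
have vE : (`|z| / Num.sqrt t) ^+ 2 = z ^+ 2 / t.
  by rewrite exprMn exprVn st real_normK // num_real.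
have hs := heat_factor_double t0.
have := poly_gauss_bound p v0; rewrite vE /heat_kernel.
have -> : z ^+ 2 / t / 4 = z ^+ 2 / (4 * t) by field; lra.
have -> : z ^+ 2 / t / 8 = z ^+ 2 / (4 * (2 * t)) by field; lra.
move=> hp.
have i0 : 0 <= (Num.sqrt t)^-1 ^+ p by rewrite exprn_ge0 // invr_ge0 ltW.
have q0 : 0 <= (1 + `|z| / Num.sqrt t) ^+ p by rewrite exprn_ge0 // addr_ge0.
have r0 : 0 <= (Num.sqrt (4 * pi * t))^-1 by rewrite invr_ge0 sqrtr_ge0.
have E0 := expR_ge0 (- (z ^+ 2 / (4 * t))).
set i := (Num.sqrt t)^-1 ^+ p in i0 *; set q := (1 + _) ^+ p in q0 hp *.
set r1 := (Num.sqrt (4 * pi * t))^-1 in r0 hs *.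
set r2 := (Num.sqrt (4 * pi * (2 * t)))^-1 in hs *.
set E1 := expR (- (_ / (4 * t))) in E0 hp *; set E2 := expR (- _) in hp *.
rewrite [leLHS](_ : _ = A * i * (r1 * (q * E1))); last by ring.
rewrite [leRHS](_ : _ = A * i * (2 * r2 * (p`!%:R * expR 3 * E2))); last by ring.
by rewrite ler_wpM2l ?mulr_ge0 // ler_pM // mulr_ge0.
Qed.

(** An integrable dominating function that is uniform for t in [a, b] and u within
    distance 1 of x: what differentiation under the integral sign needs, both in
    space and in time. *)
Lemma dkernel_dominated {R : realType} (p : nat) (a b x : R) : 0 < a ->
  exists2 C : R, 0 <= C & forall t u y : R, a <= t -> t <= b -> `|u - x| <= 1 ->
  `|dkernel p t (u - y)| <= C * heat_kernel (4 * b) (x - y).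
Proof.
move=> a0; have [C C0 HC] := @dkernel_gauss_bound R p.
pose D := C * (Num.sqrt a)^-1 ^+ p * (Num.sqrt (4 * pi * (2 * a)))^-1 *
  expR (8 * b)^-1 * Num.sqrt (4 * pi * (4 * b)).
exists D.
  by rewrite !mulr_ge0 ?invr_ge0 ?sqrtr_ge0 ?expR_ge0 // exprn_ge0 // invr_ge0
    sqrtr_ge0.
move=> t u y at_ tb ux.
have t0 : 0 < t by lra.
have b0 : 0 < b by lra.
have p0 := pi_gt0 R.
apply: (le_trans (HC t _ t0)); rewrite /D /heat_kernel.
have sb : Num.sqrt (4 * pi * (4 * b)) != 0.
  by rewrite gt_eqF // sqrtr_gt0 !mulr_gt0.
rewrite [leLHS]mulrA [leRHS](_ : _ = C * (Num.sqrt a)^-1 ^+ p *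
    (Num.sqrt (4 * pi * (2 * a)))^-1 *
    (expR (8 * b)^-1 * expR (- ((x - y) ^+ 2 / (4 * (4 * b)))))); last first.
  set i := (_^-1 ^+ p); set r := _^-1; set s := Num.sqrt (_ * (4 * b)) in sb *.
  by field.
apply: ler_pM; rewrite ?expR_ge0 //.
- by rewrite !mulr_ge0 ?invr_ge0 ?sqrtr_ge0 // exprn_ge0 // invr_ge0 sqrtr_ge0.
- have ha : (Num.sqrt t)^-1 <= (Num.sqrt a)^-1.
    by rewrite lef_pV2 ?posrE ?sqrtr_gt0 // ler_sqrt //; lra.
  apply: ler_pM; rewrite ?invr_ge0 ?sqrtr_ge0 //.
  + by rewrite !mulr_ge0 // exprn_ge0 // invr_ge0 sqrtr_ge0.
  + by rewrite ler_wpM2l // lerXn2r ?nnegrE ?invr_ge0 ?sqrtr_ge0.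
  + rewrite lef_pV2 ?posrE ?sqrtr_gt0 ?mulr_gt0 //.
    by rewrite ler_sqrt ?ler_pM2l ?mulr_ge0 ?mulr_gt0 ?(ltW p0) //; lra.
- rewrite -expRD ler_expR.
  have h1 : (u - y) ^+ 2 / (4 * (2 * b)) <= (u - y) ^+ 2 / (4 * (2 * t)).
    by rewrite ler_wpM2l ?sqr_ge0 // lef_pV2 ?posrE; lra.
  (* (x - y) ^ 2 <= 2 (u - y) ^ 2 + 2 (u - x) ^ 2; halving the exponent pays for it *)
  have h2 : (x - y) ^+ 2 <= 2 * (u - y) ^+ 2 + 2.
    have : (u - x) ^+ 2 <= 1 by rewrite -real_normK ?num_real // exprn_ile1.
    have := sqr_ge0 (u - y + (u - x)); rewrite !expr2; nra.
  have h3 : (x - y) ^+ 2 / (4 * (4 * b)) <=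
            (u - y) ^+ 2 / (4 * (2 * b)) + (8 * b)^-1.
    rewrite [leRHS](_ : _ = (2 * (u - y) ^+ 2 + 2) / (4 * (4 * b))); last by field; lra.
    by rewrite ler_pM2r // invr_gt0; lra.
  lra.
Qed.

(** Off a neighbourhood of 0 the kernel is small compared with a wider kernel, by
    exp (- w) <= 1 / w with w = z ^ 2 / (8 t).  Comparing with a kernel rather than
    with a constant keeps the bound integrable. *)
Lemma heat_kernel_tail {R : realType} (t d z : R) : 0 < t -> 0 < d -> d <= `|z| ->
  heat_kernel t z <= 16 * t / d ^+ 2 * heat_kernel (2 * t) z.
Proof.
move=> t0 d0 dz; rewrite /heat_kernel.
have dz2 : d ^+ 2 <= z ^+ 2.
  by rewrite -(real_normK (num_real z)) lerXn2r // nnegrE // ltW.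
have d20 : 0 < d ^+ 2 by rewrite exprn_gt0.
have -> : - (z ^+ 2 / (4 * t)) =
    - (z ^+ 2 / (4 * (2 * t))) + - (z ^+ 2 / (4 * (2 * t))) by field; lra.
rewrite expRD.
have hE : expR (- (z ^+ 2 / (4 * (2 * t)))) <= 8 * t / d ^+ 2.
  rewrite expRN -[leRHS]invrK lef_pV2 ?posrE ?expR_gt0 ?invr_gt0 ?divr_gt0 //; last lra.
  apply: (@le_trans _ _ (1 + z ^+ 2 / (4 * (2 * t)))); last exact: expR_ge1Dx.
  rewrite invf_div; apply: (@le_trans _ _ (z ^+ 2 / (8 * t))).
    by rewrite ler_pM2r // invr_gt0; lra.
  have -> : 4 * (2 * t) = 8 * t by ring.
  by rewrite lerDr.
have hs := heat_factor_double t0.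
have r0 : 0 <= (Num.sqrt (4 * pi * t))^-1 by rewrite invr_ge0 sqrtr_ge0.
have E0 := expR_ge0 (- (z ^+ 2 / (4 * (2 * t)))).
set r1 := (Num.sqrt (4 * pi * t))^-1 in r0 hs *.
set r2 := (Num.sqrt (4 * pi * (2 * t)))^-1 in hs *.
set E := expR _ in E0 hE *.
rewrite [leRHS](_ : _ = 2 * r2 * (8 * t / d ^+ 2 * E)); last by field; lra.
by rewrite ler_pM ?mulr_ge0 // ler_wpM2r.
Qed.

(** * Convolution with bounded continuous data *)

Lemma is_derive_continuous_at {R : realType} (f : R -> R) (x d : R) :
  is_derive x 1 f d -> {for x, continuous f}.
Proof.
by move=> [df _]; apply/differentiable_continuous/derivable1_diffP.
Qed.

Lemma is_derive1E {R : realType} (f : R -> R) (x d : R) :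
  is_derive x 1 f d -> derive1 f x = d.
Proof. by move=> H; rewrite derive1E derive_val. Qed.

Lemma is_derive_under_integral {R : realType} (f f' : R -> R -> R) (a u v : R)
    (G : R -> R) : u < a -> a < v ->
  (forall x, u < x < v ->
     (@lebesgue_measure R).-integrable setT (EFin \o f x)) ->
  (forall x y, u < x < v -> is_derive x 1 (f ^~ y) (f' x y)) ->
  (forall y, 0 <= G y) ->
  (@lebesgue_measure R).-integrable setT (EFin \o G) ->
  (forall x y, u < x < v -> `|f' x y| <= G y) ->
  is_derive a 1 (fun x => \int[@lebesgue_measure R]_y f x y)
                (\int[@lebesgue_measure R]_y f' a y).
Proof.
move=> ua av intf df G0 intG f'G.
have Ia : `]u, v[%classic a by rewrite /= in_itv /= ua.
have dfE x y : u < x < v -> partial1of2 f x y = f' x y.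
  by move=> /(df x y) /is_derive1E.
have H1 x : `]u, v[%classic x ->
    (@lebesgue_measure R).-integrable setT (EFin \o f x).
  by rewrite /= in_itv /= => /intf.
have H2 x y : `]u, v[%classic x -> setT y -> derivable (f ^~ y) x 1.
  by rewrite /= in_itv /= => /(df x y) [].
have H3 x y : `]u, v[%classic x -> setT y -> `|partial1of2 f x y| <= G y.
  by rewrite /= in_itv /= => xI _; rewrite dfE // f'G.
apply: DeriveDef.
  exact: (derivable_under_integral measurableT Ia H1 H2 G0 intG H3).
rewrite -derive1E.
rewrite (differentiation_under_integral measurableT Ia H1 H2 G0 intG H3).
by apply: eq_Rintegral => y _; rewrite /= dfE // ua.
Qed.

Definition dheat {R : realType} (p : nat) (g : R -> R) (x t : R) : R :=
  \int[@lebesgue_measure R]_y (g y * dkernel p t (x - y)).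

Lemma is_derive_subr {R : realType} (f : R -> R) (x y d : R) :
  is_derive (x - y) 1 f d -> is_derive x 1 (fun u => f (u - y)) d.
Proof.
move=> H; have H' := @is_derive1_comp _ f (fun u => u - y) x d _ H
  (is_deriveB (is_derive_id x (1 : R)) (is_derive_cst y x (1 : R))).
by apply: (is_derive_eq H'); rewrite subr0 mulr1.
Qed.

Lemma is_derive_subl {R : realType} (f : R -> R) (x y d : R) :
  is_derive (x - y) 1 f d -> is_derive y 1 (fun u => f (x - u)) (- d).
Proof.
move=> H; have H' := @is_derive1_comp _ f (fun u => x - u) y d _ H
  (is_deriveB (is_derive_cst x y (1 : R)) (is_derive_id y (1 : R))).
by apply: (is_derive_eq H'); rewrite sub0r mulrN1.
Qed.

Section bounded_data.
Context {R : realType} (g : R -> R) (M : R).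
Hypothesis cg : continuous g.
Hypothesis gM : forall y, `|g y| <= M.
Notation mu := (@lebesgue_measure R).

Let M0 : 0 <= M. Proof. exact: le_trans (gM 0). Qed.

Lemma continuous_conv p (t x : R) : 0 < t ->
  continuous (fun y => g y * dkernel p t (x - y)).
Proof.
move=> t0 y; apply: cvgM; first exact: cg.
exact: is_derive_continuous_at (is_derive_subl (is_derive_dkernel_space p (x - y) t0)).
Qed.

Lemma integrable_dominant (C t x : R) : 0 < t ->
  mu.-integrable setT (EFin \o (fun y => M * C * heat_kernel t (x - y))).
Proof.
move=> t0; rewrite /comp; under eq_fun do rewrite EFinM.
exact/integrableZl/integrable_heat_kernel.
Qed.

Lemma integrable_conv p (t x : R) : 0 < t ->
  mu.-integrable setT (EFin \o (fun y => g y * dkernel p t (x - y))).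
Proof.
move=> t0; have [C C0 HC] := dkernel_dominated p t x t0.
have t40 : 0 < 4 * t by lra.
apply: le_integrable (integrable_dominant C x t40) => //.
  apply/measurable_EFinP; apply: continuous_measurable_fun.
  exact: continuous_conv.
move=> y _ /=; rewrite lee_fin normrM [leRHS]ger0_norm; last first.
  by rewrite !mulr_ge0 // heat_kernel_ge0.
by rewrite -mulrA ler_pM // HC // subrr normr0.
Qed.

Lemma is_derive_dheat_space p (x t : R) : 0 < t ->
  is_derive x 1 (dheat p g ^~ t) (dheat p.+1 g x t).
Proof.
move=> t0; have [C C0 HC] := dkernel_dominated p.+1 t x t0.
have t40 : 0 < 4 * t by lra.
apply: (@is_derive_under_integral _ (fun u y => g y * dkernel p t (u - y))
  (fun u y => g y * dkernel p.+1 t (u - y)) x (x - 1) (x + 1)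
  (fun y => M * C * heat_kernel (4 * t) (x - y))).
- lra.
- lra.
- by move=> u _; exact: integrable_conv.
- move=> u y _; apply: is_deriveZ; apply: is_derive_subr.
  exact: is_derive_dkernel_space.
- by move=> y; rewrite !mulr_ge0 // heat_kernel_ge0.
- exact: integrable_dominant.
- move=> u y ux; rewrite normrM -mulrA ler_pM // HC //.
  by rewrite ler_norml; lra.
Qed.

Lemma is_derive_dheat_time p (x t : R) : 0 < t ->
  is_derive t 1 (dheat p g x) (dheat p.+2 g x t).
Proof.
move=> t0; have [C C0 HC] := dkernel_dominated p.+2 (2 * t) x (ltac:(lra) : 0 < t / 2).
have t80 : 0 < 4 * (2 * t) by lra.
apply: (@is_derive_under_integral _ (fun s y => g y * dkernel p s (x - y))
  (fun s y => g y * dkernel p.+2 s (x - y)) t (t / 2) (2 * t)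
  (fun y => M * C * heat_kernel (4 * (2 * t)) (x - y))).
- lra.
- lra.
- by move=> s st; apply: integrable_conv; lra.
- move=> s y st; apply: (@is_deriveZ _ _ _ (fun s => dkernel p s (x - y))).
  by apply: is_derive_dkernel_time; lra.
- by move=> y; rewrite !mulr_ge0 // heat_kernel_ge0.
- exact: integrable_dominant.
- move=> s y st; rewrite normrM -mulrA ler_pM // HC //; try lra.
  by rewrite subrr normr0.
Qed.

Lemma heat_dheat (x t : R) : 0 < t -> heat g x t = dheat 0 g x t.
Proof.
move=> t0; rewrite /heat t0 /dheat /=.
have s0 : Num.sqrt (4 * pi * t) != 0.
  by rewrite gt_eqF // sqrtr_gt0 !mulr_gt0 // pi_gt0.
have -> : (fun y => g y * expR (- ((x - y) ^+ 2 / (4 * t)))) =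
    (fun y => Num.sqrt (4 * pi * t) * (g y * heat_kernel t (x - y))).
  apply/funext => y; rewrite /heat_kernel.
  set E := expR _; set s := Num.sqrt _ in s0 *; by field.
by rewrite RintegralZl ?mulKf //; exact: (integrable_conv 0 x t0).
Qed.

Lemma heat_bound (x t : R) : `|heat g x t| <= M.
Proof.
have [t0|t0] := ltP 0 t; last by rewrite /heat ltNge t0 /=.
rewrite heat_dheat //.
apply: (le_trans (le_normr_Rintegral _ (integrable_conv 0 x t0))) => //.
rewrite -[leRHS]mulr1 -(Rintegral_heat_kernel x t0) -RintegralZl //; last first.
  exact: integrable_heat_kernel.
have := integrable_dominant 1 x t0; rewrite mulr1 => iM.
apply: le_Rintegral => //.
  exact: (integrable_norm (integrable_conv 0 x t0)).
move=> y _ /=; rewrite normrM (ger0_norm (heat_kernel_ge0 _ _)).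
by rewrite ler_wpM2r // heat_kernel_ge0.
Qed.

End bounded_data.

(** * Moving a derivative to the data, and the initial value *)

Lemma Rintegral_continuous_FTC2 {R : realType} (F f : R -> R) (a b : R) :
  a < b -> (forall x : R, is_derive x 1 F (f x)) -> continuous f ->
  \int[@lebesgue_measure R]_(x in `[a, b]) f x = F b - F a.
Proof.
move=> ab dF cf.
have cF x : {for x, continuous F} by exact: is_derive_continuous_at (dF x).
rewrite /Rintegral (@continuous_FTC2 _ f F) //.
- by apply: continuous_subspaceT.
- split.
  + by move=> x _; case: (dF x).
  + by apply: cvg_at_right_filter; exact: cF.
  + by apply: cvg_at_left_filter; exact: cF.
- by move=> x _; apply: is_derive1E.
Qed.

Lemma cvg_Rintegral_symitv {R : realType} (f : R -> R) :
  (@lebesgue_measure R).-integrable setT (EFin \o f) ->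
  \int[@lebesgue_measure R]_(x in `[(- n%:R), n%:R]) f x @[n --> \oo] -->
  \int[@lebesgue_measure R]_x f x.
Proof.
move=> intf; have mf := measurable_int _ intf.
pose F (n : nat) := (EFin \o f) \_ `[(- n%:R), n%:R].
have cv : (\int[@lebesgue_measure R]_x F n x @[n --> \oo] -->
           \int[@lebesgue_measure R]_x (EFin \o f) x)%E.
  have := @dominated_cvg _ _ R lebesgue_measure setT measurableT F (EFin \o f)
    (fun x => `|(EFin \o f) x|%E).
  apply.
  - move=> n; apply/(@measurable_restrictT _ _ _ _ _ (EFin \o f)) => //.
    exact: measurable_funTS.
  - move=> x _; apply: cvg_near_cst.
    near=> n; rewrite /F patchE ifT // inE /= in_itv /= -ler_norml.
    by near: n; exact: nbhs_infty_ger.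
  - by [].
  - exact: integrable_abse.
  - move=> n x _; rewrite /F patchE; case: ifP => _ //=.
    by rewrite normr0 lee_fin.
rewrite /Rintegral; apply: fine_cvg; rewrite fineK; last exact: integrable_fin_num.
by under eq_fun do rewrite integral_mkcond.
Unshelve. all: by end_near. Qed.

Section integration_by_parts.
Context {R : realType} (g g' : R -> R) (M M' : R).
Hypothesis dg : forall y : R, is_derive y 1 g (g' y).
Hypothesis cg' : continuous g'.
Hypothesis gM : forall y, `|g y| <= M.
Hypothesis gM' : forall y, `|g' y| <= M'.
Notation mu := (@lebesgue_measure R).

Let cg : continuous g. Proof. by move=> y; exact: is_derive_continuous_at (dg y). Qed.
Let M0 : 0 <= M. Proof. exact: le_trans (gM 0). Qed.

(** Integration by parts on the line: the integrand of the difference is the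
    derivative of y |-> g y * G_t (x - y), which vanishes at infinity. *)
Lemma dheat1_derive (x t : R) : 0 < t -> dheat 1 g x t = dheat 0 g' x t.
Proof.
move=> t0.
pose H y := g y * dkernel 0 t (x - y).
pose h y := g' y * dkernel 0 t (x - y) - g y * dkernel 1 t (x - y).
have dH (y : R) : is_derive y 1 H (h y).
  have d := is_deriveM (dg y) (is_derive_subl (is_derive_dkernel_space 0 (x - y) t0)).
  by apply: (is_derive_eq d); rewrite /h /GRing.scale /=; ring.
have ch : continuous h.
  by move=> y; apply: cvgB; exact: continuous_conv.
have i0 := integrable_conv cg' gM' 0 x t0.
have i1 := integrable_conv cg gM 1 x t0.
have ih : mu.-integrable setT (EFin \o h) := integrableB measurableT i0 i1.
apply/eqP; rewrite eq_sym -subr_eq0 /dheat -RintegralB //.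
have lim_h := cvg_Rintegral_symitv ih.
have lim_0 : \int[mu]_(y in `[(- n%:R), n%:R]) h y @[n --> \oo] --> (0 : R).
  pose D := M * (16 * t * (Num.sqrt (4 * pi * (2 * t)))^-1).
  have D0 : 0 <= D by rewrite !mulr_ge0 ?invr_ge0 ?sqrtr_ge0 //; lra.
  (* the O(1 / d ^ 2) of the tail bound, weakened to O(1 / d) for d >= 1 *)
  have tail y d : 1 <= d -> d <= `|x - y| -> `|H y| <= D / d.
    move=> d1 dxy; have d0 : 0 < d by lra.
    have r0 : 0 <= (Num.sqrt (4 * pi * (2 * t)))^-1 by rewrite invr_ge0 sqrtr_ge0.
    rewrite /H normrM (ger0_norm (heat_kernel_ge0 _ _)) -[leRHS]mulrA.
    apply: ler_pM; rewrite ?heat_kernel_ge0 //.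
    apply: (le_trans (heat_kernel_tail t0 d0 dxy)); rewrite [leRHS]mulrAC.
    apply: ler_pM; rewrite ?heat_kernel_ge0 ?mulr_ge0 ?invr_ge0 ?exprn_ge0 //; try lra.
      rewrite ler_wpM2l //; first lra.
      by rewrite lef_pV2 ?posrE ?exprn_gt0 // ler_eXnr.
    rewrite /heat_kernel ler_piMr // -[leRHS]expR0 ler_expR oppr_le0.
    by rewrite divr_ge0 ?sqr_ge0 //; lra.
  apply/cvgrPdist_le => e e0; near=> n.
  have n1 : `|x| + 1 + 2 * D / e <= n%:R by near: n; exact: nbhs_infty_ger.
  have De0 : 0 <= 2 * D / e by rewrite divr_ge0 ?mulr_ge0 // ltW.
  pose d := n%:R - `|x|.
  have d1 : 1 <= d by rewrite /d; lra.
  have xx := normr_ge0 x; have n0 : 0 <= n%:R :> R by [].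
  rewrite (@Rintegral_continuous_FTC2 _ H h) //; last by lra.
  have Dd : D / d <= e / 2.
    rewrite ler_pdivrMr; last lra.
    have : 2 * D <= d * e by rewrite -ler_pdivrMr // /d; lra.
    lra.
  have Hn : `|H n%:R| <= D / d.
    apply: tail => //; rewrite distrC /d.
    by have := lerB_normD n%:R (- x); rewrite normrN (ger0_norm n0).
  have Hn' : `|H (- n%:R)| <= D / d.
    apply: tail => //; rewrite opprK addrC /d.
    by have := lerB_normD n%:R x; rewrite (ger0_norm n0).
  have := ler_normB (H n%:R) (H (- n%:R)).
  rewrite sub0r normrN; lra.
by apply/eqP; exact: cvg_unique lim_h lim_0.
Unshelve. all: by end_near. Qed.

End integration_by_parts.

(** The kernel is an approximate identity: near x the data varies little, and
    away from x the tail of the kernel is O(t). *)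
Lemma heat_cvg_initial {R : realType} (g : R -> R) (M x : R) :
  continuous g -> (forall y, `|g y| <= M) ->
  heat g x t @[t --> 0^'+] --> g x.
Proof.
move=> cg gM; have M0 : 0 <= M by exact: le_trans (gM 0).
apply/cvgrPdist_le => e e0.
have := cg x; move/cvgrPdist_le => /(_ (e / 2)) /(_ ltac:(lra)) [d /= d0 dg].
have M64 : 0 < 64 * (M + 1) by lra.
near=> t.
have t0 : 0 < t by near: t; exact: nbhs_right_gt.
have t1 : t * (64 * (M + 1)) <= e * d ^+ 2.
  rewrite -ler_pdivlMr //.
  by near: t; apply: nbhs_right_le; rewrite divr_gt0 // mulr_gt0 // exprn_gt0.
have t20 : 0 < 2 * t by lra.
have e20 : 0 <= e / 2 by lra.
pose c := 2 * M * (16 * t / d ^+ 2).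
have d20 : 0 < d ^+ 2 by rewrite exprn_gt0.
have c0 : 0 <= c by rewrite /c !mulr_ge0 // ?invr_ge0; lra.
have ce : e / 2 + c <= e.
  have : c <= e / 2; last by lra.
  rewrite /c mulrA ler_pdivrMr //.
  by clear -t1 d20 M0 t0; nra.
have gB y : `|g y - g x| <= 2 * M.
  apply: (le_trans (ler_normB _ _)).
  by rewrite mulr_natl mulr2n lerD.
rewrite distrC (heat_dheat cg gM) // /dheat.
have i0 := integrable_conv cg gM 0 x t0.
have iK := integrable_heat_kernel x t0.
have iK2 := integrable_heat_kernel x t20.
rewrite -[g x]mulr1 -(Rintegral_heat_kernel x t0) -RintegralZl //.
have igK : (@lebesgue_measure R).-integrable setT
    (EFin \o (fun y => g x * heat_kernel t (x - y))).
  by rewrite /comp; under eq_fun do rewrite EFinM; exact: integrableZl.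
have iD := integrableB measurableT i0 igK.
rewrite -RintegralB //; apply: (le_trans (le_normr_Rintegral _ iD)) => //.
have iA : (@lebesgue_measure R).-integrable setT
   (EFin \o (fun y => e / 2 * heat_kernel t (x - y))).
  by rewrite /comp; under eq_fun do rewrite EFinM; exact: integrableZl.
have iB : (@lebesgue_measure R).-integrable setT
   (EFin \o (fun y => c * heat_kernel (2 * t) (x - y))).
  by rewrite /comp; under eq_fun do rewrite EFinM; exact: integrableZl.
apply: (@le_trans _ _ (\int[@lebesgue_measure R]_y
    (e / 2 * heat_kernel t (x - y) + c * heat_kernel (2 * t) (x - y)))).
  apply: le_Rintegral => //; first exact: integrable_norm.
    exact: (integrableD measurableT iA iB).
  move=> y _; rewrite -mulrBl normrM (ger0_norm (heat_kernel_ge0 _ _)).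
  have K0 := heat_kernel_ge0 t (x - y); have K20 := heat_kernel_ge0 (2 * t) (x - y).
  have [xyd|dxy] := ltP `|x - y| d.
    apply: (@le_trans _ _ (e / 2 * heat_kernel t (x - y))).
      by rewrite ler_wpM2r // distrC; exact: dg.
    by rewrite lerDl mulr_ge0.
  apply: (@le_trans _ _ (c * heat_kernel (2 * t) (x - y))); last first.
    by rewrite lerDr mulr_ge0.
  rewrite /c -mulrA ler_pM //; last exact: heat_kernel_tail.
by rewrite RintegralD // RintegralZl // RintegralZl // !Rintegral_heat_kernel // !mulr1.
Unshelve. all: by end_near. Qed.

(** * Decay for data bounded by a negative power *)

Lemma is_derive_powR_sqr {R : realType} (a y : R) :
  is_derive y 1 (fun y => (1 + y ^+ 2) `^ a)
                (a * (1 + y ^+ 2) `^ (a - 1) * (2 * y)).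
Proof.
have y0 : 0 < 1 + y ^+ 2 by have := sqr_ge0 y; lra.
have d1 : is_derive y (1 : R) (fun y : R => 1 + y ^+ 2) (2 * y).
  have d := is_deriveD (is_derive_cst (1 : R) y (1 : R))
    (is_deriveX 2 (is_derive_id y (1 : R))).
  by apply: (is_derive_eq d); rewrite /= expr1 /GRing.scale /= mulr1 add0r.
exact: (@is_derive1_comp _ (fun u => u `^ a) _ y _ _ (is_derive1_powR a y0) d1).
Qed.

Lemma continuous_powR_sqr {R : realType} (a : R) :
  continuous (fun y : R => (1 + y ^+ 2) `^ a).
Proof. by move=> y; exact: is_derive_continuous_at (is_derive_powR_sqr a y). Qed.

Lemma powR1norm_ge1 {R : realType} (a y : R) : 0 <= a -> 1 <= (1 + `|y|) `^ a.
Proof. by move=> a0; rewrite -[leLHS](powRr0 (1 + `|y|)) ler_powR // lerDl. Qed.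

Section weight.
Context {R : realType} (alpha : R).
Hypothesis alpha01 : 0 < alpha < 1.
Notation mu := (@lebesgue_measure R).

(** W is a smooth odd substitute for the primitive of the weight
    (1 + |y|)^(-alpha): its derivative dominates (1 - alpha) times the weight, and
    W s <= s^(1 - alpha).  It avoids splitting the integral at 0, where the
    weight is not differentiable. *)
Let W (y : R) := y * (1 + y ^+ 2) `^ (- (alpha / 2)).
Let W' (y : R) := (1 + y ^+ 2) `^ (- (alpha / 2)) +
  y * (- (alpha / 2) * (1 + y ^+ 2) `^ (- (alpha / 2) - 1) * (2 * y)).

Let is_derive_W (y : R) : is_derive y 1 W (W' y).
Proof.
have d := is_deriveM (is_derive_id y (1 : R)) (is_derive_powR_sqr (- (alpha / 2)) y).
by apply: (is_derive_eq d); rewrite /W' /GRing.scale /= mulr1 addrC.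
Qed.

Let continuous_W' : continuous W'.
Proof.
have cid : continuous (fun y : R => y) by move=> y; exact: cvg_id.
move=> y; apply: cvgD; first exact: continuous_powR_sqr.
apply: cvgM; first exact: cid.
apply: cvgM; last by apply: cvgM; [exact: cvg_cst|exact: cid].
by apply: cvgM; [exact: cvg_cst|exact: continuous_powR_sqr].
Qed.

Let weight_le_W' (y : R) : (1 - alpha) * (1 + `|y|) `^ (- alpha) <= W' y.
Proof.
have [a0 a1] := andP alpha01.
have y20 := sqr_ge0 y.
rewrite /W' powRD; last by apply/implyP => _; lra.
rewrite powR_inv1; last lra.
have y0 := normr_ge0 y.
have hP : (1 + `|y|) `^ (- alpha) <= (1 + y ^+ 2) `^ (- (alpha / 2)).
  rewrite !powRN lef_pV2 ?posrE ?powR_gt0 //; try lra.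
  have -> : (1 + `|y|) `^ alpha = ((1 + `|y|) ^+ 2) `^ (alpha / 2).
    rewrite -powR_mulrn; last lra.
    by rewrite -powRrM; congr (_ `^ _); lra.
  apply: ge0_ler_powR; rewrite ?nnegrE ?sqr_ge0 //; try lra.
  by rewrite -[in leLHS](real_normK (num_real y)) sqrrD; lra.
have P0 := powR_ge0 (1 + y ^+ 2) (- (alpha / 2)).
set P := (1 + y ^+ 2) `^ _ in hP P0 *.
rewrite [leRHS](_ : _ = P * (1 - alpha) + P * alpha / (1 + y ^+ 2)); last by field; lra.
apply: (@le_trans _ _ (P * (1 - alpha))).
  by rewrite mulrC ler_wpM2r //; lra.
by rewrite lerDl divr_ge0 ?mulr_ge0 //; lra.
Qed.

Let W_le (s : R) : 0 < s -> W s <= s * s `^ (- alpha).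
Proof.
have [a0 a1] := andP alpha01.
move=> s0; rewrite /W ler_wpM2l //; first lra.
rewrite !powRN lef_pV2 ?posrE ?powR_gt0 //; last by have := sqr_ge0 s; lra.
have -> : s `^ alpha = (s ^+ 2) `^ (alpha / 2).
  rewrite -powR_mulrn; last lra.
  by rewrite -powRrM; congr (_ `^ _); lra.
by apply: ge0_ler_powR; rewrite ?nnegrE ?sqr_ge0 //; have := sqr_ge0 s; lra.
Qed.

Lemma continuous_weight : continuous (fun y : R => (1 + `|y|) `^ (- alpha)).
Proof.
move=> y; have y0 : 0 < 1 + `|y| by have := normr_ge0 y; lra.
have h : {for 1 + `|y|, continuous (fun u : R => u `^ (- alpha))}.
  exact: is_derive_continuous_at (is_derive1_powR (- alpha) y0).
apply: (@continuous_comp _ _ _ (fun y : R => 1 + `|y|) (fun u => u `^ (- alpha)));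
  last exact: h.
by apply: cvgD; [exact: cvg_cst|exact: norm_continuous].
Qed.

Lemma integrable_weighted_kernel (t x : R) : 0 < t ->
  mu.-integrable setT (EFin \o
    (fun y => (1 + `|y|) `^ (- alpha) * heat_kernel t (x - y))).
Proof.
move=> t0; have [a0 _] := andP alpha01.
apply: (integrable_conv (M := 1) continuous_weight _ 0) => // y.
rewrite ger0_norm ?powR_ge0 // powRN.
by rewrite invf_le1 ?powR1norm_ge1 ?(ltW a0) // powR_gt0 // ltr_pwDl.
Qed.

(** The integrand is at most s^(-alpha) G_t for |y| > s := sqrt t, and at most
    s^-1 times the weight, whose integral W controls, for |y| <= s. *)
Lemma weighted_kernel_bound (t x : R) : 0 < t ->
  \int[mu]_y ((1 + `|y|) `^ (- alpha) * heat_kernel t (x - y)) <=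
  (2 / (1 - alpha) + 1) * Num.sqrt t `^ (- alpha).
Proof.
move=> t0; have [a0 a1] := andP alpha01.
set s := Num.sqrt t; have s0 : 0 < s by rewrite sqrtr_gt0.
have sa0 := powR_ge0 s (- alpha).
have b0 : 0 < 1 - alpha by lra.
pose c := (s * (1 - alpha))^-1.
have c0 : 0 <= c by rewrite invr_ge0 mulr_ge0 // ltW.
have nss : - s < s by lra.
have intW : \int[mu]_(y in `[(- s), s]) W' y = W s - W (- s).
  exact: Rintegral_continuous_FTC2.
have WW : c * (W s - W (- s)) <= 2 / (1 - alpha) * s `^ (- alpha).
  have -> : W (- s) = - W s by rewrite /W sqrrN mulNr.
  have := W_le s0; rewrite opprK => Ws.
  apply: (@le_trans _ _ (c * (s * s `^ (- alpha) + s * s `^ (- alpha)))).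
    by rewrite ler_wpM2l // lerD.
  by rewrite le_eqVlt; apply/orP; left; apply/eqP; rewrite /c; field; lra.
have iW : mu.-integrable setT (EFin \o (W' \_ `[(- s), s])).
  rewrite -restrict_EFin; apply/(@integrable_mkcond _ _ _ mu `[(- s), s]) => //.
  apply: continuous_compact_integrable; first exact: segment_compact.
  exact: continuous_subspaceT.
have icW : mu.-integrable setT (EFin \o (fun y => c * (W' \_ `[(- s), s]) y)).
  by rewrite /comp; under eq_fun do rewrite EFinM; exact: integrableZl.
have iK := integrable_heat_kernel x t0.
have isK : mu.-integrable setT
    (EFin \o (fun y => s `^ (- alpha) * heat_kernel t (x - y))).
  by rewrite /comp; under eq_fun do rewrite EFinM; exact: integrableZl.
apply: (@le_trans _ _ (\int[mu]_y (c * (W' \_ `[(- s), s]) y +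
   s `^ (- alpha) * heat_kernel t (x - y)))); last first.
  rewrite RintegralD // RintegralZl // RintegralZl // -Rintegral_mkcond intW.
  by rewrite Rintegral_heat_kernel // mulr1 mulrDl mul1r lerD2r.
apply: le_Rintegral => //; first exact: integrable_weighted_kernel.
  exact: (integrableD measurableT icW isK).
clear iK icW isK iW => y _.
have K0 := heat_kernel_ge0 t (x - y).
have w0 := powR_ge0 (1 + `|y|) (- alpha).
have wW := weight_le_W' y.
rewrite patchE; case: ifPn => ys.
  apply: (@le_trans _ _ (c * W' y)); last by rewrite lerDl mulr_ge0.
  have hK : heat_kernel t (x - y) <= s^-1.
    rewrite /heat_kernel; apply: (@le_trans _ _ (Num.sqrt (4 * pi * t))^-1).
      rewrite ler_piMr ?invr_ge0 ?sqrtr_ge0 // -[leRHS]expR0 ler_expR oppr_le0.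
      by rewrite divr_ge0 ?sqr_ge0 //; lra.
    have pi2 : 2 <= pi :> R := pi_ge2 R.
    rewrite lef_pV2 ?posrE ?sqrtr_gt0 // ?mulr_gt0 ?pi_gt0 // ler_sqrt; last first.
      by rewrite !mulr_ge0 ?pi_ge0 // ltW.
    by rewrite ler_peMl ?(ltW s0) ?(ltW t0) //; lra.
  apply: (@le_trans _ _ ((1 + `|y|) `^ (- alpha) * s^-1)).
    by rewrite ler_wpM2l.
  rewrite /c invfM -mulrA mulrC ler_wpM2l ?invr_ge0 ?(ltW s0) //.
  by rewrite ler_pdivlMl.
rewrite mulr0 add0r ler_wpM2r //.
have sy : s <= `|y|.
  rewrite leNgt; apply: contra ys => ys.
  by rewrite inE /= in_itv /= -ler_norml ltW.
have y0 := normr_ge0 y; have y1 : 0 < 1 + `|y| by lra.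
rewrite !powRN lef_pV2 ?posrE ?powR_gt0 //.
by apply: ge0_ler_powR; rewrite ?nnegrE //; lra.
Qed.

Lemma dheat_decay (kappa : R) (p : nat) : 0 <= kappa ->
  exists2 B : R, 0 <= B & forall (g : R -> R) (x t : R), continuous g ->
    (forall y, `|g y| <= kappa / (1 + `|y|) `^ alpha) -> 0 < t ->
  `|dheat p g x t| <= B * Num.sqrt t `^ (- (alpha + p%:R)).
Proof.
move=> k0; have [C C0 HC] := @dkernel_gauss_bound R p.
have [a0 a1] := andP alpha01.
pose D := 2 / (1 - alpha) + 1.
have D0 : 0 <= D by rewrite addr_ge0 // divr_ge0 //; lra.
exists (kappa * C * D); first by rewrite !mulr_ge0.
move=> g x t cg gk t0.
have gM y : `|g y| <= kappa.
  apply: (le_trans (gk y)); rewrite ler_pdivrMr; last first.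
    by apply: powR_gt0; have := normr_ge0 y; lra.
  by rewrite ler_peMr // powR1norm_ge1 // ltW.
have t20 : 0 < 2 * t by lra.
have s0 : 0 < Num.sqrt t by rewrite sqrtr_gt0.
have iw := integrable_weighted_kernel x t20.
pose c := kappa * (C * (Num.sqrt t)^-1 ^+ p).
have c0 : 0 <= c by rewrite !mulr_ge0 // exprn_ge0 // invr_ge0 ltW.
have bound := weighted_kernel_bound x t20.
have ic : mu.-integrable setT (EFin \o (fun y =>
    c * ((1 + `|y|) `^ (- alpha) * heat_kernel (2 * t) (x - y)))).
  by rewrite /comp; under eq_fun do rewrite EFinM; exact: integrableZl.
have ig := integrable_conv cg gM p x t0.
apply: (le_trans (le_normr_Rintegral measurableT ig)).
apply: (@le_trans _ _ (\int[mu]_y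
    (c * ((1 + `|y|) `^ (- alpha) * heat_kernel (2 * t) (x - y))))).
  apply: le_Rintegral => //; first exact: (integrable_norm ig).
  move=> y _ /=; rewrite normrM.
  rewrite [leRHS](_ : _ = (kappa * (1 + `|y|) `^ (- alpha)) *
    (C * (Num.sqrt t)^-1 ^+ p * heat_kernel (2 * t) (x - y))); last first.
    by rewrite /c; set i := _ ^+ p; ring.
  by rewrite ler_pM // ?HC // powRN.
rewrite (RintegralZl _ measurableT iw); apply: (le_trans (ler_wpM2l c0 bound)).
rewrite opprD powRD; last by apply/implyP => _; rewrite gt_eqF.
rewrite [in leRHS]powRN [in leRHS]powRN powR_mulrn ?(ltW s0) // -exprVn /c -/D.
have hs : Num.sqrt (2 * t) `^ (- alpha) <= (Num.sqrt t `^ alpha)^-1.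
  rewrite powRN lef_pV2 ?posrE ?powR_gt0 ?sqrtr_gt0 //.
  apply: ge0_ler_powR; rewrite ?nnegrE ?sqrtr_ge0 ?(ltW a0) // ler_sqrt //;
    last exact: ltW.
  by rewrite ler_peMl ?(ltW s0) ?(ltW t0) //; lra.
rewrite [leRHS](_ : _ = kappa * (C * (Num.sqrt t)^-1 ^+ p) *
   (D * (Num.sqrt t `^ alpha)^-1)); last first.
  by set i := _ ^+ p; set j := (_ `^ _)^-1; ring.
by rewrite ler_wpM2l // ler_wpM2l.
Qed.

End weight.

(** * Time derivatives on the closed half-line *)

Definition is_time_derive {R : realType} (g : R -> R) (t l : R) : Prop :=
  time_quotient g t @ within [set h | 0 <= t + h] (0 : R)^' --> l.

Section time_derivative.
Context {R : realType}.
Implicit Types (g : R -> R) (t l : R).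

Lemma within_future_proper t : 0 <= t ->
  ProperFilter (within [set h | 0 <= t + h] (0 : R)^').
Proof.
move=> t0; apply: Build_ProperFilter_ex => P [e /= e0 eP].
exists (e / 2); apply: eP => /=; last 2 first.
- by rewrite gt_eqF // divr_gt0.
- by rewrite addr_ge0 // divr_ge0 // ltW.
by rewrite sub0r normrN ger0_norm ?ltr_pdivrMr ?ltr_pMr //; lra.
Qed.

Lemma is_time_deriveP g t l : 0 <= t -> is_time_derive g t l ->
  time_derivable g t /\ time_derive g t = l.
Proof.
move=> t0 gl; have PF := within_future_proper t0.
split; first by apply/cvg_ex; exists l.
by apply: cvg_lim.
Qed.

Lemma eq_is_time_derive g1 g2 t l : 0 <= t -> (forall s, 0 <= s -> g1 s = g2 s) ->
  is_time_derive g1 t l -> is_time_derive g2 t l.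
Proof.
move=> t0 g12; apply: cvg_trans; apply: near_eq_cvg.
rewrite near_withinE; apply: nearW => h /= h0.
by rewrite /time_quotient !g12.
Qed.

Lemma is_derive_time_derive g t l : 0 <= t -> is_derive t 1 g l ->
  is_time_derive g t l.
Proof.
move=> t0 [dg dgl]; apply: cvg_within_filter.
have : h^-1 *: (g (h *: 1 + t) - g t) @[h --> 0^'] --> 'D_1 g t by exact: dg.
rewrite dgl; apply: cvg_trans; apply: near_eq_cvg; apply: nearW => h.
by rewrite /time_quotient /GRing.scale /= mulr1 [t + h]addrC.
Qed.

(** By the mean value theorem the difference quotient at 0 is a value of g' at an
    intermediate time. *)
Lemma is_time_derive_initial g g' :
  (forall t, 0 < t -> is_derive t 1 g (g' t)) ->
  g t @[t --> 0^'+] --> g 0 -> g' t @[t --> 0^'+] --> g' 0 ->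
  is_time_derive g 0 (g' 0).
Proof.
move=> dg g0 g'0; apply/cvgrPdist_le => e e0.
move/cvgrPdist_le : g'0 => /(_ _ e0) [d /= d0 dP].
rewrite near_withinE; near=> h => /=; rewrite add0r => h0.
have hd : `|h| < d by near: h; exact: dnbhs0_lt.
have hn0 : h != 0 by near: h; exact: nbhs_dnbhs_neq.
have {hn0}h0' : 0 < h by rewrite lt_neqAle eq_sym hn0.
have cg : {within `[0, h], continuous g}.
  have cg x : 0 < x -> {for x, continuous g}.
    by move=> x0; exact: is_derive_continuous_at (dg x x0).
  apply/continuous_within_itvP => //; split => //.
    by move=> x; rewrite in_itv /= => /andP[x0 _]; exact: cg.
  by apply: cvg_at_left_filter; exact: cg.
have dg' x : x \in `]0, h[ -> is_derive x 1 g (g' x).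
  by rewrite in_itv /= => /andP[x0 _]; exact: dg.
have [c] := MVT h0' dg' cg; rewrite in_itv /= => /andP[c0 ch] gE.
rewrite /time_quotient add0r gE subr0 mulrC mulfK ?gt_eqF //.
apply: dP => //=; rewrite sub0r normrN gtr0_norm //.
by apply: lt_trans ch _; rewrite gtr0_norm in hd.
Unshelve. all: by end_near. Qed.

End time_derivative.

(** * Derivatives of the heat flow of smooth data *)

Section heat_flow.
Context {R : realType}.

Lemma heat0 (f : R -> R) x : heat f x 0 = f x.
Proof. by rewrite /heat ltxx. Qed.

Section smooth_data.
Variables (g g' : R -> R) (M M' : R).
Hypothesis dg : forall y : R, is_derive y 1 g (g' y).
Hypothesis cg' : continuous g'.
Hypothesis gM : forall y, `|g y| <= M.
Hypothesis gM' : forall y, `|g' y| <= M'.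

Let cg : continuous g.
Proof. by move=> y; exact: is_derive_continuous_at (dg y). Qed.

Lemma is_derive_heat_space (x t : R) : 0 <= t ->
  is_derive x 1 (heat g ^~ t) (heat g' x t).
Proof.
rewrite le_eqVlt => /predU1P[<-|t0].
  rewrite heat0 (_ : (fun _ => _) = g) //.
  by apply/funext => y; rewrite heat0.
rewrite (heat_dheat cg' gM') // -(dheat1_derive dg cg' gM gM') //.
rewrite (_ : (fun _ => _) = dheat 0 g ^~ t).
  exact: is_derive_dheat_space.
by apply/funext => y; rewrite (heat_dheat cg gM).
Qed.

(** Both sides are the space derivative of dheat 1 g = dheat 0 g'. *)
Lemma dheat2_derive (x t : R) : 0 < t -> dheat 2 g x t = dheat 1 g' x t.
Proof.
move=> t0.
have d1 := is_derive_dheat_space cg gM 1 x t0.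
have d2 := is_derive_dheat_space cg' gM' 0 x t0.
rewrite -(is_derive1E d1) -(is_derive1E d2); congr (derive1 _ x).
by apply/funext => y; exact: dheat1_derive.
Qed.

End smooth_data.

Lemma is_time_derive_heat (g g1 g2 : R -> R) (M M1 M2 : R) :
  (forall y : R, is_derive y 1 g (g1 y)) ->
  (forall y : R, is_derive y 1 g1 (g2 y)) ->
  continuous g2 ->
  (forall y, `|g y| <= M) -> (forall y, `|g1 y| <= M1) ->
  (forall y, `|g2 y| <= M2) ->
  forall x t : R, 0 <= t -> is_time_derive (heat g x) t (heat g2 x t).
Proof.
move=> dg dg1 cg2 gM gM1 gM2 x.
have cg : continuous g by move=> y; exact: is_derive_continuous_at (dg y).
have cg1 : continuous g1 by move=> y; exact: is_derive_continuous_at (dg1 y).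
have dt (t : R) : 0 < t -> is_derive t 1 (heat g x) (heat g2 x t).
  move=> t0; rewrite (heat_dheat cg2 gM2) // -(dheat1_derive dg1 cg2 gM1 gM2) //.
  rewrite -(dheat2_derive dg cg1 gM gM1) //.
  apply: near_eq_is_derive (is_derive_dheat_time cg gM 0 x t0).
  near=> s; rewrite (heat_dheat cg gM) //.
  by near: s; exact: (lt_nbhsr t0).
move=> t; rewrite le_eqVlt => /predU1P[<-|t0]; last first.
  by apply: is_derive_time_derive; [exact: ltW|exact: dt].
by apply: (is_time_derive_initial dt); rewrite heat0; exact: heat_cvg_initial.
Unshelve. all: by end_near. Qed.

End heat_flow.

(** * The estimate *)

Lemma Lnorm_oo_le {R : realType} (f : R -> R) (c : R) :
  (forall x, `|f x| <= c) ->
  ('N[@lebesgue_measure R]_+oo[EFin \o f] <= c%:E)%E.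
Proof.
move=> fc; rewrite unlock; case: ifPn => _.
  by apply/ess_supP; apply: nearW => x /=; rewrite lee_fin.
by rewrite lee_fin; apply: le_trans (fc 0).
Qed.

Lemma sqrt_powR_decay {R : realType} (tau b t : R) : 0 < tau -> 0 <= b -> tau <= t ->
  Num.sqrt t `^ (- b) <= (1 + tau^-1) `^ (b / 2) / (1 + t) `^ (b / 2).
Proof.
move=> tau0 b0 taut; have t0 : 0 < t by lra.
have i0 : 0 < tau^-1 by rewrite invr_gt0.
have b2 : 0 <= b / 2 by lra.
rewrite powRN -powR12_sqrt ?(ltW t0) // -powRrM (_ : 2^-1 * b = b / 2); last by ring.
rewrite ler_pdivlMr ?powR_gt0 //; last lra.
rewrite ler_pdivrMl ?powR_gt0 //.
rewrite [leRHS]mulrC -powRM //; try lra.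
apply: ge0_ler_powR; rewrite ?nnegrE //; try lra.
  by rewrite mulr_ge0 //; lra.
rewrite mulrDl mul1r addrC lerD2l.
by rewrite ler_pdivlMl // mulr1.
Qed.

(** For bounded continuous data and t > 0 all derivatives fall on the kernel. *)
Section positive_times.
Context {R : realType} (g : R -> R) (M : R).
Hypothesis cg : continuous g.
Hypothesis gM : forall y, `|g y| <= M.

Lemma derive1n_heat_dheat k (s : R) : 0 < s ->
  derive1n k (heat g ^~ s) = dheat k g ^~ s.
Proof.
move=> s0; elim: k => [|k IH].
  by apply/funext => x; exact: heat_dheat cg gM _ _ s0.
rewrite derive1nS IH; apply/funext => x.
by apply: is_derive1E; exact: is_derive_dheat_space cg gM _ _ _ s0.
Qed.

Lemma dtdx_heat_dheat n k (x t : R) : 0 < t ->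
  dtdx n k (heat g) x t = dheat (2 * n + k) g x t /\
  is_time_derive (dtdx n k (heat g) x) t (dheat (2 * n + k).+2 g x t).
Proof.
have step m : (forall t, 0 < t -> dtdx m k (heat g) x t = dheat (2 * m + k) g x t) ->
    forall t, 0 < t ->
    is_time_derive (dtdx m k (heat g) x) t (dheat (2 * m + k).+2 g x t).
  move=> IH s s0; apply: is_derive_time_derive; first exact: ltW.
  apply: near_eq_is_derive (is_derive_dheat_time cg gM (2 * m + k) x s0).
  by near=> u; apply/esym/IH; near: u; exact: (lt_nbhsr s0).
elim: n t => [|n IH] t t0.
  have e0 s : 0 < s -> dtdx 0 k (heat g) x s = dheat (2 * 0 + k) g x s.
    by move=> s0; rewrite /dtdx /= derive1n_heat_dheat.
  by split; [exact: e0|exact: step].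
have e1 s : 0 < s -> dtdx n.+1 k (heat g) x s = dheat (2 * n.+1 + k) g x s.
  move=> s0; have [_ /(is_time_deriveP (ltW s0)) [_ E]] := IH s s0.
  by rewrite mulnS; exact: E.
by split; [exact: e1|exact: step].
Unshelve. all: by end_near. Qed.

Lemma has_dtdx_heat_pos n k : has_dtdx n k (heat g) [set t | 0 < t].
Proof.
split=> i x s _ /= s0.
  by rewrite derive1n_heat_dheat //; case: (is_derive_dheat_space cg gM i x s0).
have [_ H] := dtdx_heat_dheat i k x s0.
by case: (is_time_deriveP (ltW s0) H).
Qed.

End positive_times.

(** For data with N bounded continuous derivatives D 0, ..., D N the flow of D i is
    differentiated by raising i, up to and including t = 0. *)
Section all_times.
Context {R : realType} (D : nat -> R -> R) (L : nat -> R) (N : nat).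
Hypothesis dD : forall i (y : R), (i < N)%N -> is_derive y 1 (D i) (D i.+1 y).
Hypothesis cD : forall i, (i <= N)%N -> continuous (D i).
Hypothesis DL : forall i y, (i <= N)%N -> `|D i y| <= L i.

Lemma derive1n_heat k (s : R) : (k <= N)%N -> 0 <= s ->
  derive1n k (heat (D 0) ^~ s) = heat (D k) ^~ s.
Proof.
move=> + s0; elim: k => [//|k IH] kN.
rewrite derive1nS IH; last exact: ltnW.
apply/funext => x; apply: is_derive1E.
apply: (is_derive_heat_space (M := L k) (M' := L k.+1)) => //.
- by move=> y; exact: dD.
- exact: cD.
- by move=> y; apply: DL; exact: ltnW.
- by move=> y; exact: DL.
Qed.

Lemma is_time_derive_heat_data k x t : (k.+2 <= N)%N -> 0 <= t ->
  is_time_derive (heat (D k) x) t (heat (D k.+2) x t).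
Proof.
move=> kN t0; have kN1 := ltnW kN; have kN0 := ltnW kN1.
apply: (@is_time_derive_heat _ (D k) (D k.+1) (D k.+2) (L k) (L k.+1) (L k.+2)) => //.
- by move=> y; exact: dD.
- by move=> y; exact: dD.
- exact: cD.
- by move=> y; exact: DL.
- by move=> y; exact: DL.
- by move=> y; exact: DL.
Qed.

Lemma dtdx_heat n k x t : (2 * n + k <= N)%N -> 0 <= t ->
  dtdx n k (heat (D 0)) x t = heat (D (2 * n + k)) x t.
Proof.
elim: n t => [|n IH] t nk t0; first by rewrite /dtdx /= derive1n_heat.
have nk' : ((2 * n + k).+2 <= N)%N by move: nk; rewrite mulnS.
have H := @is_time_derive_heat_data _ x t nk' t0.
have e s : 0 <= s -> heat (D (2 * n + k)) x s = dtdx n k (heat (D 0)) x s.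
  by move=> s0; rewrite IH //; apply: leq_trans nk'; rewrite leqW.
have [_ E] := is_time_deriveP t0 (eq_is_time_derive t0 e H).
by rewrite mulnS; exact: E.
Qed.

Lemma has_dtdx_heat n k : (2 * n + k <= N)%N ->
  has_dtdx n k (heat (D 0)) [set t | 0 <= t].
Proof.
move=> nk; split=> i x s ni /= s0.
  have iN : (i < N)%N by apply: leq_trans ni (leq_trans (leq_addl _ _) nk).
  rewrite derive1n_heat ?(ltnW iN) //.
  suff [] : is_derive x 1 (heat (D i) ^~ s) (heat (D i.+1) x s) by [].
  apply: (is_derive_heat_space (M := L i) (M' := L i.+1)) => //.
  - by move=> y; exact: dD.
  - exact: cD.
  - by move=> y; apply: DL; exact: ltnW.
  - by move=> y; exact: DL.
have nk' : ((2 * i + k).+2 <= N)%N.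
  apply: leq_trans nk; rewrite -[leqLHS]/(2 + 2 * i + k)%N.
  by rewrite -mulnS leq_add2r leq_mul2l.
have H := @is_time_derive_heat_data _ x s nk' s0.
have e u : 0 <= u -> heat (D (2 * i + k)) x u = dtdx i k (heat (D 0)) x u.
  by move=> u0; rewrite dtdx_heat //; apply: leq_trans nk'; rewrite leqW.
by have [] := is_time_deriveP s0 (eq_is_time_derive s0 e H).
Qed.

End all_times.

Section initial_data_facts.
Context {R : realType} (kappa1 kappa2 alpha : R) (lambda : nat -> R) (j : nat)
  (f0 : R -> R).
Hypothesis kappa1_gt0 : 0 < kappa1.
Hypothesis alpha_gt0 : 0 < alpha.
Hypothesis data : initial_data kappa1 kappa2 alpha lambda j f0.

Lemma initial_data_derive i (y : R) : (i < j)%N ->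
  is_derive y 1 (derive1n i f0) (derive1n i.+1 f0 y).
Proof.
move=> ij; case: data => _ [df _] _ _.
by apply: DeriveDef; [exact: df|rewrite derive1nS derive1E].
Qed.

Lemma initial_data_continuous i : (i <= j)%N -> continuous (derive1n i f0).
Proof.
rewrite leq_eqVlt => /predU1P[->|ij]; first by case: data => _ [].
by move=> y; exact: is_derive_continuous_at (initial_data_derive y ij).
Qed.

Lemma initial_data_le i y : (i <= j)%N -> `|derive1n i f0 y| <= lambda i.
Proof.
move=> ij; case: data => _ _ _ /(_ i ij) [l0 /(_ y)] H.
apply: (le_trans H); have a0 : 0 <= alpha + i%:R by rewrite addr_ge0 // ltW.
have h1 := powR1norm_ge1 y a0.
by rewrite ler_pdivrMr ?ler_peMr ?(ltW l0) // (lt_le_trans _ h1).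
Qed.

Lemma initial_data_weight y : `|f0 y| <= kappa2 / (1 + `|y|) `^ alpha.
Proof.
case: data => _ _ /(_ y) [h1 h2] _; rewrite ger0_norm //.
by apply: le_trans h1; rewrite divr_ge0 ?powR_ge0 // ltW.
Qed.

End initial_data_facts.

Lemma dheat_decay_time {R : realType} (kappa1 kappa2 alpha tau : R) (n k : nat) :
  0 < kappa1 -> 0 < kappa2 -> 0 < alpha < 1 -> 0 < tau ->
  exists2 K : R, 0 <= K &
    forall (lambda : nat -> R) (j : nat) (f0 : R -> R),
    initial_data kappa1 kappa2 alpha lambda j f0 ->
    forall x t : R, tau <= t ->
    `|dheat (2 * n + k) f0 x t| <= K / (1 + t) `^ (alpha / 2 + n%:R + k%:R / 2).
Proof.
move=> k10 k20 a01 tau0; have [a0 a1] := andP a01.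
have [B B0 HB] := dheat_decay a01 (2 * n + k) (ltW k20).
pose b := alpha + (2 * n + k)%:R.
have b0 : 0 <= b by rewrite addr_ge0 // ltW.
exists (B * (1 + tau^-1) `^ (b / 2)); first by rewrite mulr_ge0 ?powR_ge0.
move=> lambda j f0 data x t taut.
have t0 : 0 < t by lra.
have cf := initial_data_continuous data (leq0n j).
apply: (le_trans (HB f0 x t cf (initial_data_weight k10 data) t0)).
rewrite -mulrA ler_wpM2l //.
have -> : alpha / 2 + n%:R + k%:R / 2 = b / 2 by rewrite /b natrD natrM; lra.
exact: sqrt_powR_decay.
Qed.

Unset Implicit Arguments.

Theorem proposition1p4 (R : realType) (kappa1 kappa2 alpha : R) (n k : nat)
    (hkappa1 : 0 < kappa1) (hkappa2 : 0 < kappa2)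
    (halpha : 0 < alpha /\ alpha < 1) :
  (forall lambda : nat -> R,
     exists K : R, 0 < K /\
     forall (j : nat) (f0 : R -> R),
       initial_data kappa1 kappa2 alpha lambda j f0 ->
       (2 * n + k <= j)%N ->
       has_dtdx n k (heat f0) [set t | 0 <= t] /\
       forall t : R, 0 <= t ->
         ('N[@lebesgue_measure R]_+oo[EFin \o (dtdx n k (heat f0) ^~ t)]
          <= (K / (1 + t) `^ (alpha / 2 + n%:R + k%:R / 2))%:E)%E)
  /\
  (forall tau : R, 0 < tau ->
     exists K : R, 0 < K /\
     forall (lambda : nat -> R) (j : nat) (f0 : R -> R),
       initial_data kappa1 kappa2 alpha lambda j f0 ->
       (n + k <= j)%N ->
       has_dtdx n k (heat f0) [set t | 0 < t] /\
       forall t : R, tau <= t ->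
         ('N[@lebesgue_measure R]_+oo[EFin \o (dtdx n k (heat f0) ^~ t)]
          <= (K / (1 + t) `^ (alpha / 2 + n%:R + k%:R / 2))%:E)%E).
Proof.
have a01 : 0 < alpha < 1 by apply/andP.
have a0 := halpha.1.
set e := alpha / 2 + n%:R + k%:R / 2.
have e0 : 0 <= e by rewrite /e !addr_ge0 ?divr_ge0 // ltW.
have lift K t : 0 <= t -> 0 <= K -> K / (1 + t) `^ e <= (K + 1) / (1 + t) `^ e.
  by move=> t0 K0; rewrite ler_wpM2r ?invr_ge0 ?powR_ge0 // lerDl.
(* K may vanish in the auxiliary estimates; adding 1 makes it positive *)
split=> [lambda|tau tau0]; last first.
  have [K K0 HK] := dheat_decay_time n k hkappa1 hkappa2 a01 tau0.
  exists (K + 1); split; first by rewrite ltr_wpDl.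
  move=> lambda j f0 data nk.
  have cf := initial_data_continuous data (leq0n j).
  have fL y := initial_data_le a0 data y (leq0n j).
  split; first exact: has_dtdx_heat_pos cf fL n k.
  move=> t taut; have t0 : 0 < t by exact: lt_le_trans taut.
  apply: Lnorm_oo_le => x; rewrite (dtdx_heat_dheat cf fL n k x t0).1.
  by apply: (le_trans (HK _ _ _ data x t taut)); apply: lift => //; exact: ltW.
(* tau = 1: decay for t >= 1, and the bound by lambda for t <= 1 *)
have [K K0 HK] := dheat_decay_time n k hkappa1 hkappa2 a01 (@ltr01 R).
set p := (2 * n + k)%N.
have K1 : 0 <= `|lambda p| * 2 `^ e by rewrite mulr_ge0 ?powR_ge0.
exists (K + `|lambda p| * 2 `^ e + 1); split.
  by rewrite ltr_wpDl // addr_ge0.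
move=> j f0 data nk.
have dD := initial_data_derive data.
have cD := initial_data_continuous data.
have DL i y := @initial_data_le _ _ _ _ _ _ _ a0 data i y.
split; first exact: (has_dtdx_heat dD cD DL).
move=> t t0; apply: Lnorm_oo_le => x.
apply: (@le_trans _ _ ((K + `|lambda p| * 2 `^ e) / (1 + t) `^ e)); last first.
  by apply: lift => //; rewrite addr_ge0.
rewrite mulrDl.
have q0 : 0 <= K / (1 + t) `^ e by rewrite divr_ge0 ?powR_ge0.
have q1 : 0 <= `|lambda p| * 2 `^ e / (1 + t) `^ e by rewrite divr_ge0 ?powR_ge0.
have [t1|/ltW t1] := leP 1 t.
  have tp : 0 < t by exact: lt_le_trans t1.
  have fL y := DL 0 y (leq0n j).
  rewrite (dtdx_heat_dheat (cD 0 (leq0n j)) fL n k x tp).1.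
  by apply: (le_trans (HK _ _ _ data x t t1)); rewrite lerDl.
rewrite (dtdx_heat dD cD DL x nk t0).
apply: (le_trans (heat_bound (cD p nk) (fun y => DL p y nk) x t)).
apply: (@le_trans _ _ (`|lambda p| * 2 `^ e / (1 + t) `^ e)); last by rewrite lerDr.
apply: (le_trans (ler_norm _)); rewrite -mulrA ler_peMr //.
rewrite ler_pdivlMr ?mul1r ?powR_gt0 ?ltr_pwDl //.
have t2 : 1 + t <= 2 by lra.
by apply: ge0_ler_powR => //; rewrite nnegrE //; lra.
Qed.
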